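(* For almost all (in the sense of Lebesgue measure on $[0,1]^2$) pairs $(\alpha,\beta)\in[0,1]^2$ the following holds: if $q_0,q_1,\ldots,q_n,\ldots$ and $r_0,r_1,\ldots,r_n,\ldots$ are the denominators of the convergents of the regular continued fraction expansions of $\alpha$ and $\beta$, respectively, then $$\liminf_{n\to\infty}\left|\int_1^{q_n}\psi_\alpha(\xi)\,d\xi-\int_1^{r_n}\psi_\beta(\xi)\,d\xi\right|<+\infty.$$
   Context: For a real irrational number $\alpha$ and real $t\ge 1$, $\psi_\alpha(t)=\min_{1\le q\le t}\|q\alpha\|$, where $q$ runs over integers and $\|\cdot\|$ denotes the distance to the nearest integer. The $n$-th convergent of $\alpha=[a_0;a_1,a_2,\ldots]$ is $p_n/q_n=[a_0;a_1,\ldots,a_n]$ (in lowest terms, $q_n>0$, so $q_0=1$). *)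

(* Defs.v *)
From mathcomp Require Import all_boot all_order all_algebra.
From mathcomp Require Import all_classical all_reals all_analysis.
Set Implicit Arguments.
Unset Strict Implicit.
Unset Printing Implicit Defensive.
Import Order.TTheory GRing.Theory Num.Theory.
Local Open Scope classical_set_scope.
Local Open Scope ring_scope.

(* The distance ||x|| to the nearest integer; the infimum is attained. *)
Definition dist_int (R : realType) (x : R) : R :=
  inf [set `|x - m%:~R| | m in [set: int]].

(* For t >= 1 the index q = 1 belongs to the range, so the default value
   ||alpha|| of the iterated minimum does not affect the result. *)
Definition psi (R : realType) (alpha t : R) : R :=
  \big[Num.min/dist_int alpha]_(1 <= q < (Num.truncn t).+1)
    dist_int (q%:R * alpha).

(* Meaningful for irrational alpha: for rational alpha some fractional part is 0
   and, since 0^-1 = 0, the sequence vanishes from the next index on. *)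
Definition complete_quotient (R : realType) (alpha : R) (n : nat) : R :=
  iter n (fun x => (x - (Num.floor x)%:~R)^-1) alpha.

Definition partial_quotient (R : realType) (alpha : R) (n : nat) : int :=
  Num.floor (complete_quotient alpha n).

(* [a 0; a 1, ..., a n] *)
Fixpoint cfrac (a : nat -> int) (n : nat) : rat :=
  if n is n'.+1 then (a 0%N)%:Q + (cfrac (fun k => a k.+1) n')^-1
  else (a 0%N)%:Q.

Definition convergent (R : realType) (alpha : R) (n : nat) : rat :=
  cfrac (partial_quotient alpha) n.

Definition cf_denom (R : realType) (alpha : R) (n : nat) : int :=
  denq (convergent alpha n).

Definition psi_integral (R : realType) (alpha : R) (n : nat) : R :=
  \int[lebesgue_measure]_(xi in `[1, (cf_denom alpha n)%:~R]) psi alpha xi.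

(* Main.v *)
Require Import Defs.
From mathcomp Require Import all_boot all_order all_algebra.
From mathcomp Require Import all_classical all_reals all_analysis.
From mathcomp Require Import measurable_realfun.
From mathcomp Require Import ring lra zify.
Set Implicit Arguments.
Unset Strict Implicit.
Unset Printing Implicit Defensive.
Import Order.TTheory GRing.Theory Num.Theory.
Import numFieldNormedType.Exports.
Local Open Scope classical_set_scope.
Local Open Scope ring_scope.

(** Write delta_k for the distance |q_k alpha - p_k|.  By the theorem of best
    approximation psi_alpha is constant, equal to delta_k, on [q_k, q_(k+1)),
    so its integral up to q_n is the sum over k < n of
    (q_(k+1) - q_k) * delta_k.  Each summand lies in [0, 1] and equals
    (1 - y) / (1 + y * x), where x is the (k+1)-st point of the orbit of alpha
    under the Gauss map (the future of the expansion) and y = q_k / q_(k+1)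
    (its past).  These sums are the function [cost], and the identification
    with the integral is [psi_integral_cost].

    Let D_n be the difference of the sums for alpha and beta.  As D_n moves by
    at most 1 at each step, |D_n| cannot tend to infinity without D_n keeping
    a constant sign from some point on.  The exceptional pairs are therefore
    those of the set [outgrows], where D_n tends to +oo, and their mirror
    images.

    The set [outgrows] is null for the following reason.  Fix alpha.  Replacing
    beta by 1 / (a + beta) inserts one digit in front of its expansion: this
    adds one bounded term and changes the past seen by the other terms, but the
    influence of the past decays geometrically ([cost_lipschitz]), so D_n
    changes by a bounded amount ([cost_branch]).  Hence each section of
    [outgrows] is stable under all inverse branches of the Gauss map.  Their
    compositions have bounded distortion ([branch_distortion]) and contract to
    any prescribed irrational point of (0, 1), so a set of positive measure
    which they preserve has density 0 at none of these points; by the density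
    theorem of Lebesgue it has full measure ([zero_one]).  So every section is
    null or of full measure.  On the other hand alpha and beta cannot outgrow
    each other, and Fubini's theorem shows that an antisymmetric relation whose
    sections are all null or full is null ([antisymmetric_zero_one]). *)

(** * The Gauss map and the cost of an expansion *)

Section GaussMap.
Context {R : realType}.
Implicit Types (x y t : R) (a : int).

Definition unit_irr : set R := [set x | 0 < x < 1 /\ irrational x].

Definition digit x : int := Num.floor x^-1.

Definition gauss x : R := x^-1 - (digit x)%:~R.

Lemma irrationalV x : irrational x -> irrational x^-1.
Proof.
move=> ix [q _ qx]; apply: ix; exists q^-1 => //.
by rewrite fmorphV/= qx invrK.
Qed.

Lemma irrationalDz a x : irrational x -> irrational (a%:~R + x).
Proof.
move=> ix [q _ qx]; apply: ix; exists (q - a%:~R) => //.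
by rewrite rmorphB/= ratr_int qx addrC addKr.
Qed.

Lemma irrational_int a x : irrational x -> x != a%:~R.
Proof.
by move=> ix; apply/eqP => xa; apply: ix; exists a%:~R => //; rewrite ratr_int.
Qed.

Lemma unit_irr_itv x : x \in `[0, 1] -> irrational x -> unit_irr x.
Proof.
rewrite in_itv/= => /andP[x0 x1] ix; split => //.
rewrite !lt_neqAle x0 x1 !andbT eq_sym.
by rewrite (irrational_int 0 ix) (irrational_int 1 ix).
Qed.

Lemma digit_ge1 x : unit_irr x -> 1 <= digit x.
Proof.
move=> [/andP[x0 x1] _]; rewrite /digit floor_ge_int.
by rewrite invf_ge1// ltW.
Qed.

Lemma gauss_unit_irr x : unit_irr x -> unit_irr (gauss x).
Proof.
move=> [/andP[x0 x1] ix]; apply: unit_irr_itv.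
  rewrite in_itv/= /gauss /digit subr_ge0 floor_le/= lerBlDl ltW//.
  by have := floorD1_gt x^-1; rewrite intrD.
by rewrite /gauss addrC -mulrNz; exact/irrationalDz/irrationalV.
Qed.

Lemma branch_unit_irr a t : 1 <= a -> unit_irr t -> unit_irr (a%:~R + t)^-1.
Proof.
move=> a1 [/andP[t0 t1] it]; split; last exact/irrationalV/irrationalDz.
have a1' : 1 <= a%:~R :> R by rewrite ler1z.
have at0 : 0 < a%:~R + t by lra.
by rewrite invr_gt0 at0 invf_lt1//; lra.
Qed.

Lemma digit_branch a t : unit_irr t -> digit (a%:~R + t)^-1 = a.
Proof.
move=> [/andP[t0 t1] _]; rewrite /digit invrK; apply: floor_def.
by rewrite intrD lerDl ltW//= ltrD2l.
Qed.

Lemma gauss_branch a t : unit_irr t -> gauss (a%:~R + t)^-1 = t.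
Proof. by move=> ut; rewrite /gauss digit_branch// invrK addrC addKr. Qed.

Lemma branch_gauss x : ((digit x)%:~R + gauss x)^-1 = x.
Proof. by rewrite /gauss addrC subrK invrK. Qed.

(** If y is q_(k-1) / q_k and x is the k-th point of the orbit, this is
    q_k / q_(k+1). *)
Definition past x y : R := ((digit x)%:~R + y)^-1.

(** The past is an argument, and starts from 0 for the expansion of a number,
    so that sums from different starting pasts can be compared and the sum
    unfolds from the left along the Gauss map. *)
Fixpoint cost n x y : R :=
  if n is m.+1 then
    (1 - past x y) / (1 + past x y * gauss x) + cost m (gauss x) (past x y)
  else 0.

Lemma past_itv x y : unit_irr x -> 0 <= y -> 0 < past x y <= 1.
Proof.
move=> /digit_ge1; rewrite -(ler1z R) => d1 y0; rewrite /past.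
have dy0 : 0 < (digit x)%:~R + y by lra.
by rewrite invr_gt0 dy0 invf_le1//; lra.
Qed.

Lemma cost_increment n x y : unit_irr x -> 0 <= y ->
  0 <= cost n.+1 x y - cost n x y <= 1.
Proof.
elim: n x y => [|n IHn] x y ux y0; have /andP[p0 p1] := past_itv ux y0;
  have ug := gauss_unit_irr ux.
  rewrite /= addr0 subr0; have [/andP[g0 g1] _] := ug.
  have pg := mulr_gt0 p0 g0.
  by rewrite divr_ge0 ?ler_pdivrMr; lra.
have := IHn _ _ ug (ltW p0).
by rewrite [cost n.+2 _ _]/= [cost n.+1 x _]/= opprD addrACA subrr add0r.
Qed.


(** The influence of the past is summable: the map y |-> 1 / (d + y) contracts
    and a term is 2-Lipschitz in its past.  The weight
    1 / ((1 + y) (1 + y')) is what makes a one-step induction close: the map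
    multiplies y - y' by 1 / ((d + y) (d + y')), and the weighted bound at the
    next step is at most half of the present one. *)
Lemma cost_lipschitz n x y y' : unit_irr x -> 0 <= y <= 1 -> 0 <= y' <= 1 ->
  `|cost n x y - cost n x y'| <= 4 * `|y - y'| / ((1 + y) * (1 + y')).
Proof.
elim: n x y y' => [|n IHn] x y y' ux /andP[y0 y1] /andP[y'0 y'1] /=.
  by rewrite subrr normr0 divr_ge0 ?mulr_ge0 ?addr_ge0.
have ug := gauss_unit_irr ux; have [/andP[g0 g1] _] := ug.
have /andP[p0 p1] := past_itv ux y0; have /andP[p'0 p'1] := past_itv ux y'0.
have : `|cost n (gauss x) (past x y) - cost n (gauss x) (past x y')| <=
    4 * `|past x y - past x y'| / ((1 + past x y) * (1 + past x y')).
  by apply: IHn => //; rewrite ltW.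
have d1 : 1 <= (digit x)%:~R :> R by rewrite ler1z digit_ge1.
have yy' : past x y - past x y' =
    (y' - y) / (((digit x)%:~R + y) * ((digit x)%:~R + y')).
  by rewrite /past; field; apply/andP; split; apply/lt0r_neq0; lra.
have -> : (1 + past x y) * (1 + past x y') =
   (((digit x)%:~R + y + 1) * ((digit x)%:~R + y' + 1)) /
   (((digit x)%:~R + y) * ((digit x)%:~R + y')).
  by rewrite /past; field; apply/andP; split; apply/lt0r_neq0; lra.
set c := cost n _ _; set c' := cost n _ _ => IH.
have hh' : (1 - past x y) / (1 + past x y * gauss x) -
    (1 - past x y') / (1 + past x y' * gauss x) =
    (past x y' - past x y) * ((1 + gauss x) / ((1 + past x y * gauss x) *
      (1 + past x y' * gauss x))).
  have := mulr_gt0 p0 g0; have := mulr_gt0 p'0 g0 => *.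
  by field; apply/andP; split; apply/lt0r_neq0; lra.
set K := (1 + gauss x) / _ in hh' *.
have /andP[K0 K2] : 0 <= K <= 2.
  have := mulr_gt0 p0 g0; have := mulr_gt0 p'0 g0 => *.
  by rewrite /K divr_ge0 ?mulr_ge0 ?ler_pdivrMr ?mulr_gt0/=; nra.
set U := (digit x)%:~R + y in yy' IH *.
set U' := (digit x)%:~R + y' in yy' IH *.
have [U0 yU] : 0 < U /\ 1 + y <= U by rewrite /U; split; lra.
have [U'0 yU'] : 0 < U' /\ 1 + y' <= U' by rewrite /U'; split; lra.
have normP : `|past x y - past x y'| = `|y - y'| / (U * U').
  by rewrite yy' normrM distrC normfV [`|_ * _|]gtr0_norm// mulr_gt0.
have {}IH : `|c - c'| <= 4 * `|y - y'| / ((U + 1) * (U' + 1)).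
  apply: le_trans IH _; rewrite normP le_eqVlt; apply/orP; left; apply/eqP.
  by field; rewrite !lt0r_neq0//; lra.
have UZ : (U * U')^-1 <= ((1 + y) * (1 + y'))^-1.
  by rewrite lef_pV2 ?posrE ?mulr_gt0//; [apply: ler_pM => //|..]; lra.
have VZ : ((U + 1) * (U' + 1))^-1 <= (2 * ((1 + y) * (1 + y')))^-1.
  by rewrite lef_pV2 ?posrE ?mulr_gt0//; nra.
have dP : `|past x y' - past x y| * K <= `|y - y'| / (U * U') * 2.
  rewrite distrC normP; apply: ler_pM => //.
  by rewrite divr_ge0// mulr_ge0// ltW.
rewrite opprD addrACA hh' (le_trans (ler_normD _ _))// normrM (ger0_norm K0).
apply: le_trans (lerD dP IH) _.
rewrite [X in _ <= X]invfM in VZ; move: UZ VZ; have := normr_ge0 (y - y').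
move: (`|y - y'|) ((U * U')^-1) (((1 + y) * (1 + y'))^-1) => D Z W.
move: (((U + 1) * (U' + 1))^-1) => V D0 ZW VW.
by have := ler_wpM2l D0 ZW; have := ler_wpM2l D0 VW; lra.
Qed.

(** The inserted digit creates one more term, at most 1, and moves the past of
    the other ones from 0 to at most 1, which costs at most 4 altogether. *)
Lemma cost_branch n a t : 1 <= a -> unit_irr t ->
  cost n (a%:~R + t)^-1 0 <= cost n t 0 + 5.
Proof.
move=> a1 ut; have ub := branch_unit_irr a1 ut.
case: n => [|n]; first by rewrite /= add0r.
rewrite [X in X <= _]/=.
have /andP[p0 p1] := past_itv ub (lexx 0).
have [/andP[t0 t1] _] := ut.
move: p0 p1; rewrite gauss_branch//; set p := past _ _ => p0 p1.
have pt := mulr_gt0 p0 t0.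
have : (1 - p) / (1 + p * t) <= 1 by rewrite ler_pdivrMr; lra.
have /andP[inc0 _] := cost_increment n ut (lexx 0).
have : `|cost n t p - cost n t 0| <= 4.
  apply: le_trans (cost_lipschitz _ ut _ _) _; rewrite ?lexx ?ler01 ?(ltW p0)//.
  by rewrite subr0 addr0 mulr1 gtr0_norm// ler_pdivrMr; lra.
by rewrite ler_norml => /andP[]; lra.
Qed.

End GaussMap.

(** * Numerators and denominators of convergents *)

Section ContinuedFractions.

(** The recursion consumes the first partial quotient, as [cfrac] does; the
    usual three-term recurrence, which adds the last one, is [cf_rec]. *)
Fixpoint cfpair (a : nat -> int) (n : nat) : int * int :=
  if n is m.+1 then
    let: (p, q) := cfpair (fun k => a k.+1) m in (a 0%N * p + q, p)
  else (a 0%N, 1).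

Definition cfnum a n := (cfpair a n).1.
Definition cfden a n := (cfpair a n).2.

Lemma cfnumS a n : cfnum a n.+1 =
  a 0%N * cfnum (fun k => a k.+1) n + cfden (fun k => a k.+1) n.
Proof. by rewrite /cfnum /cfden /=; case: cfpair. Qed.

Lemma cfdenS a n : cfden a n.+1 = cfnum (fun k => a k.+1) n.
Proof. by rewrite /cfnum /cfden /=; case: cfpair. Qed.

Lemma cf_rec a n : cfnum a n.+2 = a n.+2 * cfnum a n.+1 + cfnum a n /\
  cfden a n.+2 = a n.+2 * cfden a n.+1 + cfden a n.
Proof.
elim: n a => [|n IHn] a.
  by rewrite !(cfnumS, cfdenS) /cfnum /cfden /=; split; ring.
have [IHnum IHden] := IHn (fun k => a k.+1).
rewrite (cfnumS a n.+2) (cfdenS a n.+2) IHnum IHden.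
rewrite (cfnumS a n.+1) (cfnumS a n) (cfdenS a n.+1) (cfdenS a n).
by split; ring.
Qed.

Lemma cf_gt0 a n : (forall k, 1 <= a k) -> 1 <= cfnum a n /\ 1 <= cfden a n.
Proof.
elim: n a => [|n IHn] a a1; first by split; rewrite /cfnum/cfden/=.
have [] := IHn (fun k => a k.+1) (fun k => a1 k.+1).
rewrite cfnumS cfdenS => num1 den1; split => //.
by have := a1 0%N; nia.
Qed.

Lemma cfden_ge1 a n : (forall k, 1 <= a k.+1) -> 1 <= cfden a n.
Proof.
by case: n => [//|n] a1; rewrite cfdenS; case: (@cf_gt0 (fun k => a k.+1) n).
Qed.

Lemma cf_coprime a n : coprimez (cfnum a n) (cfden a n).
Proof.
elim: n a => [|n IHn] a; first by rewrite /coprimez /gcdz /cfden/= gcdn1.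
rewrite cfnumS cfdenS coprimez_sym /coprimez gcdzMDl; exact: IHn.
Qed.

Lemma cfracE a n : (forall k, 1 <= a k.+1) ->
  cfrac a n = (cfnum a n)%:~R / (cfden a n)%:~R.
Proof.
elim: n a => [|n IHn] a a1; first by rewrite /cfnum/cfden/= divr1.
rewrite /= IHn// cfnumS cfdenS invf_div intrD intrM.
have [num1 _] := @cf_gt0 (fun k => a k.+1) n a1.
move: (cfnum _ n) (cfden _ n) num1 => N D N1.
by field; rewrite intr_eq0; lia.
Qed.

Lemma cf_denq a n : (forall k, 1 <= a k.+1) -> denq (cfrac a n) = cfden a n.
Proof.
move=> a1; rewrite cfracE//; have := cfden_ge1 n a1 => den1.
rewrite coprimeq_den; last exact: cf_coprime.
by rewrite ifF; lia.
Qed.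

Lemma cf_det a n : cfnum a n.+1 * cfden a n - cfnum a n * cfden a n.+1 =
  (- 1) ^+ n.
Proof.
elim: n => [|n IHn]; first by rewrite cfnumS cfdenS /cfnum/cfden/=; ring.
by have [-> ->] := cf_rec a n; rewrite exprS -IHn; ring.
Qed.

End ContinuedFractions.

(** * The integral of psi as a sum over convergents *)

Section Convergents.
Context {R : realType} (alpha : R) (ualpha : unit_irr alpha).

Local Notation x k := (iter k gauss alpha).
Local Notation a := (partial_quotient alpha).
Local Notation p k := (cfnum (partial_quotient alpha) k).
Local Notation q k := (cfden (partial_quotient alpha) k).

Lemma orbit_unit_irr k : unit_irr (x k).
Proof. by elim: k => [//|k IHk]; rewrite iterS; exact: gauss_unit_irr. Qed.

Lemma partial_quotient0 : a 0 = 0.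
Proof.
have [/andP[x0 x1] _] := ualpha.
by apply: floor_def; rewrite add0r (ltW x0).
Qed.

Lemma complete_quotientS k : complete_quotient alpha k.+1 = (x k)^-1.
Proof.
elim: k => [|k IHk].
  by rewrite /complete_quotient/= -[Num.floor _]/(a 0) partial_quotient0 subr0.
by rewrite [LHS]iterS -[iter _ _ _]/(complete_quotient alpha k.+1) IHk.
Qed.

Lemma partial_quotientS k : a k.+1 = digit (x k).
Proof. by rewrite /partial_quotient complete_quotientS. Qed.

Lemma partial_quotient_ge1 k : 1 <= a k.+1.
Proof. by rewrite partial_quotientS; exact/digit_ge1/orbit_unit_irr. Qed.

Lemma cf_denomE k : cf_denom alpha k = q k.
Proof.
by rewrite /cf_denom /convergent cf_denq//; exact: partial_quotient_ge1.
Qed.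

Lemma orbit_inv k : (x k)^-1 = (a k.+1)%:~R + x k.+1.
Proof. by rewrite partial_quotientS iterS /gauss addrC subrK. Qed.

Lemma orbit_gt0 k : 0 < x k.
Proof. by have [/andP[]] := orbit_unit_irr k. Qed.

Lemma orbitM k : x k * ((a k.+1)%:~R + x k.+1) = 1.
Proof. by rewrite -orbit_inv divff// gt_eqF// orbit_gt0. Qed.

(** The distance |q_k alpha - p_k|: see [gapE]. *)
Definition gap k : R := \prod_(i < k.+1) x i.

Lemma gapS k : gap k.+1 = gap k * x k.+1.
Proof. by rewrite /gap big_ord_recr. Qed.

Lemma gap0 : gap 0 = alpha.
Proof. by rewrite /gap big_ord1. Qed.

Lemma gap_gt0 k : 0 < gap k.
Proof. by apply: prodr_gt0 => i _; exact: orbit_gt0. Qed.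

Lemma gapE k : (q k)%:~R * alpha - (p k)%:~R = (-1) ^+ k * gap k.
Proof.
suff: (q k)%:~R * alpha - (p k)%:~R = (-1) ^+ k * gap k /\
  (q k.+1)%:~R * alpha - (p k.+1)%:~R = (-1) ^+ k.+1 * gap k.+1 by case.
elim: k => [|k [IHk IHk1]].
  rewrite !(cfnumS, cfdenS, gapS) gap0 /cfnum /cfden /= partial_quotient0.
  have := orbitM 0; rewrite /= mul0r add0r mul1r subr0 mulN1r.
  by move=> e; split=> //; rewrite -[1%:~R]e; ring.
split=> //; have [-> ->] := cf_rec a k.
rewrite !(intrD, intrM) mulrDl opprD addrACA IHk -mulrA -mulrBr IHk1.
rewrite !exprS !gapS.
have -> : (a k.+2)%:~R = (x k.+1)^-1 - x k.+2 by rewrite orbit_inv addrK.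
by field; rewrite gt_eqF ?orbit_gt0.
Qed.

Lemma gap_cfden k : gap k * ((q k.+1)%:~R + (q k)%:~R * x k.+1) = 1.
Proof.
elim: k => [|k IHk].
  by rewrite gap0 cfdenS /cfnum /cfden /= mul1r; exact: (orbitM 0).
have [_ ->] := cf_rec a k; rewrite gapS -[RHS]IHk intrD intrM.
transitivity (gap k * ((q k.+1)%:~R *
   (x k.+1 * ((a k.+2)%:~R + x k.+2)) + (q k)%:~R * x k.+1)); first by ring.
by rewrite orbitM mulr1.
Qed.

Lemma orbit_cfden_ge1 k : 1 <= q k.
Proof. by apply: cfden_ge1; exact: partial_quotient_ge1. Qed.

Lemma cfden_le k : q k <= q k.+1.
Proof.
case: k => [|k]; first exact: orbit_cfden_ge1.
have [_ ->] := cf_rec a k.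
have := orbit_cfden_ge1 k.+1; have := orbit_cfden_ge1 k.
by have := partial_quotient_ge1 k.+1; nia.
Qed.

(** Best approximation: (l, m) is an integer combination u (p_k, q_k) +
    v (p_(k+1), q_(k+1)), the two pairs having determinant 1 or -1.  As
    0 < m < q_(k+1), u is nonzero and v is zero or of the opposite sign; since
    the errors q_k alpha - p_k alternate in sign, the two contributions to
    m alpha - l add up in absolute value. *)
Lemma gap_best k (m l : int) : 1 <= m < q k.+1 ->
  gap k <= `|m%:~R * alpha - l%:~R|.
Proof.
move=> /andP[m1 mq].
have det : (p k.+1 * q k - p k * q k.+1) * (p k.+1 * q k - p k * q k.+1) = 1.
  by rewrite cf_det -expr2 sqrr_sign.
set s := p k.+1 * q k - p k * q k.+1 in det.
pose u := s * (m * p k.+1 - l * q k.+1).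
pose v := s * (l * q k - m * p k).
have mE : m = u * q k + v * q k.+1.
  by rewrite -[LHS]mul1r -det /u /v /s; ring.
have lE : l = u * p k + v * p k.+1.
  by rewrite -[LHS]mul1r -det /u /v /s; ring.
clearbody u v.
have -> : m%:~R * alpha - l%:~R =
    (-1) ^+ k * (u%:~R * gap k - v%:~R * gap k.+1).
  rewrite {}mE {}lE !(intrD, intrM).
  transitivity (u%:~R * ((q k)%:~R * alpha - (p k)%:~R) +
    v%:~R * ((q k.+1)%:~R * alpha - (p k.+1)%:~R)); first by ring.
  by rewrite !gapE exprS; ring.
rewrite normrM normrX normrN1 expr1n mul1r.
have q0 := orbit_cfden_ge1 k; have q1 := orbit_cfden_ge1 k.+1.
have g0 := gap_gt0 k; have g1 := gap_gt0 k.+1.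
have [u1|u1] := lerP 1 u.
  have v0 : v <= 0 by nia.
  have u1' : 1 <= u%:~R :> R by rewrite ler1z.
  have v0' : v%:~R <= 0 :> R by rewrite lerz0.
  by rewrite ger0_norm; nra.
have u0 : u <= -1.
  rewrite leNgt; apply/negP => u0; have {u0 u1}u0 : u = 0 by lia.
  by move: m1 mq; rewrite mE u0 mul0r add0r; have [v0|v1] := lerP v 0; nia.
have v0 : 0 <= v.
  rewrite leNgt; apply/negP => v0.
  have : u * q k <= 0 by rewrite mulr_le0_ge0//; lia.
  have : v * q k.+1 <= 0 by rewrite mulr_le0_ge0//; lia.
  by lia.
have u1' : u%:~R <= -1 :> R by rewrite -(mulrNz 1 1) ler_int.
have v0' : 0 <= v%:~R :> R by rewrite ler0z.
by rewrite ler0_norm; nra.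
Qed.

Lemma dist_int_ge (r c : R) :
  (forall l : int, c <= `|r - l%:~R|) -> c <= dist_int r.
Proof.
move=> cr; apply: lb_le_inf; first by exists `|r - 0%:~R|, 0.
by move=> _ [l _ <-].
Qed.

Lemma dist_int_le (r : R) (l : int) : dist_int r <= `|r - l%:~R|.
Proof. by apply: ge_inf; [exists 0 => _ [m _ <-] | exists l]. Qed.

(** The case q_k = q_(k+1) is void: it occurs for k = 0 and alpha > 1/2, when
    alpha - p_0 is not the distance from alpha to the nearest integer. *)
Lemma psi_gap k t : (q k)%:~R <= t < (q k.+1)%:~R -> psi alpha t = gap k.
Proof.
move=> /andP[qt tq].
have q0 := orbit_cfden_ge1 k; have q1 := orbit_cfden_ge1 k.+1.
have t1 : 1 <= t by apply: le_trans qt; rewrite ler1z.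
have t0 : 0 <= t by lra.
have qk_lt : q k < q k.+1 by rewrite -(ltr_int R); exact: le_lt_trans tq.
have best m : (1 <= m < (Num.truncn t).+1)%N ->
    gap k <= dist_int (m%:R * alpha).
  move=> /andP[m1 mt]; apply: dist_int_ge => l.
  apply: (@gap_best k m l); apply/andP; split; first by lia.
  rewrite -(ltr_int R); apply: le_lt_trans tq.
  have tt : (Num.truncn t)%:R <= t by rewrite truncn_le.
  by rewrite -pmulrn (le_trans _ tt)// ler_nat -ltnS.
apply/eqP; rewrite eq_le; apply/andP; split.
  have qkt : (`|q k|.-1 < Num.truncn t)%N.
    apply: (@leq_trans `|q k|); first by lia.
    by rewrite truncn_ge_nat// natr_absz ger0_norm//; lia.
  rewrite /psi big_add1 big_mkord.
  (* the indices are shifted by 1, so q_k is the one of rank q_k - 1 *)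
  apply: (le_trans (bigmin_le _ (Ordinal qkt) _)) => /=.
  apply: (le_trans (dist_int_le _ (p k))).
  rewrite prednK; last by lia.
  rewrite natr_absz (ger0_norm (ltW (lt_le_trans ltr01 q0))).
  by rewrite gapE normrM normrX normrN1 expr1n mul1r gtr0_norm// gap_gt0.
rewrite /psi big_seq_cond; apply: le_bigmin => [|m].
  by have := best 1; rewrite mul1r; apply; rewrite ltnS truncn_ge_nat.
by rewrite mem_index_iota andbT; exact: best.
Qed.

Lemma psi_ge0 t : 0 <= psi alpha t.
Proof.
have dist_ge0 r : 0 <= dist_int r :> R by apply: dist_int_ge => l.
by apply: le_bigmin.
Qed.

Lemma measurable_psi (D : set R) : measurable D -> measurable_fun D (psi alpha).
Proof.
move=> mD; apply: nonincreasing_measurable => // s t st.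
by apply: le_bigmin_nat => //; rewrite ltnS le_truncn.
Qed.

Lemma psi_integral_sum k :
  psi_integral alpha k = \sum_(j < k) ((q j.+1)%:~R - (q j)%:~R) * gap j.
Proof.
rewrite /psi_integral /Rintegral cf_denomE -integral_itv_bndo_bndc; last first.
  by apply/measurable_EFinP; apply: measurable_psi.
suff -> : (\int[lebesgue_measure]_(t in `[1%R, (q k)%:~R[) (psi alpha t)%:E)%E =
  (\sum_(j < k) ((q j.+1)%:~R - (q j)%:~R) * gap j)%:E by [].
elim: k => [|k IHk].
  rewrite big_ord0 [X in `[_, X[](_ : _ = 1)//.
  by rewrite set_itvco0 integral_set0.
have qk1 : 1 <= (q k)%:~R :> R by rewrite ler1z orbit_cfden_ge1.
have qkk : (q k)%:~R <= (q k.+1)%:~R :> R by rewrite ler_int cfden_le.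
rewrite big_ord_recr/= EFinD -IHk.
rewrite (@itv_bndbnd_setU _ _ _ (BLeft (q k)%:~R)) ?bnd_simp//.
rewrite ge0_integral_setU//=; last 3 first.
- by apply/measurable_EFinP; apply: measurable_psi; exact: measurableU.
- by move=> t _; rewrite lee_fin psi_ge0.
- rewrite disj_set2E; apply/eqP/seteqP; split => // t [] /=.
  by rewrite !in_itv/= => /andP[_ /lt_le_trans tq] /andP[/tq]; rewrite ltxx.
congr (_ + _)%E.
transitivity (\int[lebesgue_measure]_(t in `[(q k)%:~R, (q k.+1)%:~R[)
  (cst (gap k)%:E t))%E.
  apply: eq_integral => t; rewrite inE/= in_itv/= => /psi_gap ->//.
rewrite integral_cst//= lebesgue_measure_itv/= lte_fin.
case: ltP => [_|qk]; first by rewrite -EFinM mulrC.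
by rewrite mule0 (le_anti (introT andP (conj qkk qk))) subrr mul0r.
Qed.

(** Here q_(-1) = 0, whence the value 0 at k = 0. *)
Definition den_ratio k : R := if k is j.+1 then (q j)%:~R / (q k)%:~R else 0.

Lemma cfden_neq0 k : (q k)%:~R != 0 :> R.
Proof. by rewrite intr_eq0; have := orbit_cfden_ge1 k; lia. Qed.

Lemma past_den_ratio k : past (x k) (den_ratio k) = den_ratio k.+1.
Proof.
rewrite /past -partial_quotientS; case: k => [|k].
  by rewrite /den_ratio addr0 mul1r.
rewrite [den_ratio k.+2]/= [den_ratio k.+1]/=.
have q1 := cfden_neq0 k.+1; have q2 := cfden_neq0 k.+2.
have [_ qE] := cf_rec a k.
rewrite -[RHS]invf_div; congr (_^-1); rewrite qE intrD intrM mulrDl mulfK//.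
Qed.

Lemma cost_orbit n k : cost n (x k) (den_ratio k) =
  \sum_(j < n) ((q (k + j).+1)%:~R - (q (k + j))%:~R) * gap (k + j).
Proof.
elim: n k => [|n IHn] k; first by rewrite big_ord0.
rewrite [LHS]/= past_den_ratio -iterS IHn big_ord_recl addn0; congr (_ + _).
  have q1 := cfden_neq0 k.+1.
  have g1 := gap_cfden k.
  have qg : (q k.+1)%:~R + (q k)%:~R * x k.+1 != 0 :> R.
    by apply: contra_eq_neq g1 => ->; rewrite mulr0 eq_sym oner_eq0.
  have -> : gap k = ((q k.+1)%:~R + (q k)%:~R * x k.+1)^-1.
    by apply: (mulIf qg); rewrite mulVf.
  by rewrite /den_ratio; field; apply/andP; split.
by apply: eq_bigr => j _; rewrite /= /bump addnS addSn.
Qed.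

Lemma psi_integral_cost n : psi_integral alpha n = cost n alpha 0.
Proof. by rewrite psi_integral_sum (cost_orbit n 0). Qed.

End Convergents.

(** * Zero-one law for sets stable under the inverse branches *)

Section ZeroOne.
Context {R : realType}.
Local Notation mu := (@lebesgue_measure R).

(** Cover E by open intervals of total length close to its measure.  The points
    of A sent into an interval of length l are at distance at most L * l from
    each other, hence lie in an interval of length L * l. *)
Lemma lebesgue_expanding (A E : set R) (f : R -> R) (L : R) :
  measurable A -> 0 < L ->
  (forall t, A t -> E (f t)) ->
  (forall s t, A s -> A t -> `|s - t| <= L * `|f s - f t|) ->
  (mu A <= L%:E * mu E)%E.
Proof.
move=> mA L0 AE exp.
have -> : mu E = ((wlength idfun)^*%mu E) by [].
rewrite muleC -lee_pdivrMr// outer_measure_open_itv_cover.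
apply: le_ereal_inf_tmp => _ /= [F [Fitv EF] <-].
rewrite lee_pdivrMr// muleC -nneseriesZl; last first.
  by move=> k _; exact: wlength_ge0.
pose B k := A `&` f @^-1` F k.
pose G k := if pselect (B k = set0) then set0
  else `[inf (B k), sup (B k)]%classic.
have diam k s t : B k s -> B k t ->
    ((s - t)%:E <= L%:E * wlength idfun (F k))%E.
  have [[a b] /= Fk] := Fitv k; rewrite /B /= Fk wlength_itv/=.
  move=> [As]; rewrite in_itv/= => /andP[as_ sb].
  move=> [At]; rewrite in_itv/= => /andP[at_ tb].
  rewrite lte_fin (lt_trans as_ sb) -EFinB -EFinM lee_fin.
  apply: le_trans (ler_norm _) _; apply: le_trans (exp _ _ As At) _.
  by rewrite ler_wpM2l ?(ltW L0)// ler_norml; apply/andP; split; lra.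
have mG k : measurable (G k : set (measurableTypeR R)).
  by rewrite /G; case: pselect => _ /=.
have AG : A `<=` \bigcup_k G k.
  move=> t At; have [k _ Fkt] := EF _ (AE _ At); exists k => //.
  have Bkt : B k t by [].
  rewrite /G; case: pselect => [Bk0|nBk] /=; first by rewrite Bk0 in Bkt.
  have [c Lc] : exists c, wlength idfun (F k) = c%:E.
    have [[a b] /= Fk] := Fitv k; rewrite Fk wlength_itv/=.
    by case: ifP => _; [exists (b - a) | exists 0].
  rewrite /= in_itv/= ge_inf ?ub_le_sup//.
    exists (t + L * c) => s Bs; have := diam k _ _ Bs Bkt.
    by rewrite Lc lee_fin; lra.
  exists (t - L * c) => s Bs; have := diam k _ _ Bkt Bs.
  by rewrite Lc lee_fin; lra.
apply: (le_trans (measure_sigma_subadditive _ mG mA AG)).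
apply: lee_nneseries => // k _; rewrite /G.
case: pselect => [Bk0|/eqP/set0P[t0 Bt0]] /=.
  by rewrite measure0 mule_ge0 ?wlength_ge0// lee_fin ltW.
rewrite lebesgue_measure_itv/= lte_fin; case: ifP => _; last first.
  by rewrite mule_ge0 ?wlength_ge0// lee_fin ltW.
have [c Lc] : exists c, wlength idfun (F k) = c%:E.
  have [[a b] /= Fk] := Fitv k; rewrite Fk wlength_itv/=.
  by case: ifP => _; [exists (b - a) | exists 0].
rewrite Lc -EFinB lee_fin lerBlDr.
apply: ge_sup; first by exists t0.
move=> s Bs; rewrite -lerBlDl; apply: lb_le_inf; first by exists t0.
by move=> t Bt; have := diam k _ _ Bs Bt; rewrite Lc lee_fin; lra.
Qed.

(** The inverse branch of the n-th iterate of the Gauss map whose range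
    contains x. *)
Fixpoint branch n (x t : R) : R :=
  if n is m.+1 then branch m x ((digit (iter m gauss x))%:~R + t)^-1 else t.

Lemma branch_orbit n x : branch n x (iter n gauss x) = x.
Proof. by elim: n => [//|n IHn]; rewrite /= branch_gauss. Qed.

Lemma branch_closed (A : set R) n x t : unit_irr x ->
  (forall (a : int) s, 1 <= a -> A s -> A (a%:~R + s)^-1) ->
  A t -> A (branch n x t).
Proof.
move=> ux Ab; elim: n t => [//|n IHn] t At /=.
by apply: IHn; apply: Ab => //; exact/digit_ge1/orbit_unit_irr.
Qed.

(** The numbers u and v are q_n and q_(n-1): the branch is the Moebius map
    t |-> (p_n + t p_(n-1)) / (q_n + t q_(n-1)), of determinant 1 or -1.  On
    [0, 1] it divides distances by a number between u^2 and 4 u^2, and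
    u + v > n makes its range shrink. *)
Lemma branch_distortion n x : unit_irr x ->
  exists u v : R, [/\ 0 <= v <= u, 1 <= u, n.+1%:R <= u + v &
    forall s t, 0 <= s -> 0 <= t ->
    `|branch n x s - branch n x t| = `|s - t| / ((u + s * v) * (u + t * v))].
Proof.
move=> ux; elim: n => [|n [u [v [/andP[v0 vu] u1 nuv IHn]]]].
  exists 1, 0; rewrite lexx ler01 addr0 lexx; split=> // s t _ _.
  by rewrite !mulr0 addr0 mulr1 divr1.
have : 1 <= digit (iter n gauss x).
  exact/digit_ge1/orbit_unit_irr.
rewrite -(ler1z R) => /=; move: (digit _)%:~R => d d1.
exists (u * d + v), u; split; [apply/andP; split; nra|nra| |].
  by rewrite -natr1; nra.
move=> s t s0 t0.
have ds0 : 0 < d + s by lra.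
have dt0 : 0 < d + t by lra.
rewrite IHn ?invr_ge0 ?ltW//.
have -> : (d + s)^-1 - (d + t)^-1 = (t - s) / ((d + s) * (d + t)).
  by field; rewrite !gt_eqF.
rewrite normrM distrC normfV (gtr0_norm (mulr_gt0 ds0 dt0)).
have su0 : 0 <= s * u by rewrite mulr_ge0//; lra.
have tu0 : 0 <= t * u by rewrite mulr_ge0//; lra.
have ud0 : u <= u * d by nra.
by field; rewrite !gt_eqF//; nra.
Qed.

Lemma unit_irr_measurable : measurable (unit_irr : set R).
Proof.
have -> : unit_irr = `]0%R, 1%R[%classic `&` ~` @rational R.
  by apply/seteqP; split => t; rewrite /unit_irr /= in_itv.
apply: measurableI => //; apply: measurableC.
apply: countable_measurable => //.
by apply: (sub_countable (card_image_le _ _)); exact: countableP.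
Qed.

(** Near an irrational x, the n-th branch through x maps A into A and into the
    ball of centre x and radius 1 / u^2, and it shrinks measures by at most
    4 u^2; so A fills a proportion at least mu A / 8 of this ball.  If
    mu A > 0, the density of A at x is therefore not 0, whereas it is 0 at
    almost every point outside A. *)
Lemma zero_one (A : set R) : measurable A -> A `<=` unit_irr ->
  (forall (a : int) t, 1 <= a -> A t -> A (a%:~R + t)^-1) ->
  mu A = 0%E \/ mu.-negligible (unit_irr `\` A).
Proof.
move=> mA Au Ab; have [A0|An0] := eqVneq (mu A) 0%E; [by left|right].
have mu_unit : mu (`[0, 1] : set R) = 1%E.
  by rewrite lebesgue_measure_itv/= lte_fin ltr01 -EFinB subr0.
have A1 : (mu A <= 1)%E.
  rewrite -mu_unit le_measure ?inE// => t /Au[/andP[t0 t1] _].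
  by rewrite /= in_itv/= !ltW.
have [m muA] : exists m, mu A = m%:E.
  exists (fine (mu A)); rewrite fineK//.
  by rewrite ge0_fin_numE// (le_lt_trans A1)// ltry.
have m0 : 0 < m by rewrite -lte_fin -muA lt_neqAle measure_ge0 eq_sym An0.
have := lebesgue_density mA; apply: negligibleS => x [ux nAx] /= dens.
have {}dens : (mu (A `&` ball x r) * (mu (ball x r))^-1)%E
    @[r --> 0^'+] --> 0%E.
  by move: dens; rewrite indicE memNset.
have /dens : nbhs (0 : R)%:E [set y | (y < (m / 8)%:E)%E].
  by apply: (@nbhs_open_ereal_lt _ _ (fun=> m / 8)); rewrite divr_gt0.
move=> [d /= d0 near0].
pose n := Num.truncn (2 / d).
have [u [v [/andP[v0 vu] u1 nuv dist]]] := branch_distortion n ux.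
have u0 : 0 < u by lra.
have uu0 : 0 < u * u by rewrite mulr_gt0.
have r0 : 0 < (u * u)^-1 by rewrite invr_gt0.
have rd : (u * u)^-1 < d.
  have : 2 / d < n.+1%:R by exact: truncnS_gt.
  rewrite ltr_pdivrMr// => n2.
  rewrite -ltf_pV2 ?posrE// invrK.
  have d2 : d^-1 < u by rewrite -(ltr_pM2r d0) mulVf ?gt_eqF//; nra.
  by nra.
have := orbit_unit_irr ux n; have := branch_orbit n x.
set xn := iter n gauss x => xE orb.
have [/andP[xn0 xn1] _] := orb.
have den_ge s : 0 <= s -> u <= u + s * v by move=> s0; rewrite lerDl mulr_ge0.
have den_le s : s <= 1 -> u + s * v <= 2 * u by nra.
have into_ball t : A t -> (A `&` ball x (u * u)^-1) (branch n x t).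
  move=> At; split; first exact: branch_closed At.
  have [/andP[t0 t1] _] := Au _ At.
  rewrite /ball/= -{1}xE dist ?(ltW xn0) ?(ltW t0)//.
  have D_ge : u * u <= (u + xn * v) * (u + t * v).
    by apply: ler_pM; rewrite ?(ltW u0) ?den_ge ?(ltW xn0) ?(ltW t0).
  have D0 := lt_le_trans uu0 D_ge.
  rewrite ltr_pdivrMr//; apply: (@lt_le_trans _ _ 1).
    by rewrite ltr_norml; apply/andP; split; lra.
  by rewrite -(ler_pM2l uu0) mulr1 mulrA divff ?gt_eqF// mul1r.
have expanding s t : A s -> A t ->
    `|s - t| <= 4 * (u * u) * `|branch n x s - branch n x t|.
  move=> /Au[/andP[s0 s1] _] /Au[/andP[t0 t1] _].
  have [s_ge t_ge] := (den_ge _ (ltW s0), den_ge _ (ltW t0)).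
  have [s_le t_le] := (den_le _ (ltW s1), den_le _ (ltW t1)).
  have D0 : 0 < (u + s * v) * (u + t * v) by rewrite mulr_gt0//; lra.
  rewrite dist ?(ltW s0) ?(ltW t0)// mulrCA ler_peMr//.
  rewrite ler_pdivlMr// mul1r.
  have -> : 4 * (u * u) = (2 * u) * (2 * u) by ring.
  by apply: ler_pM => //; lra.
have uu4 : 0 < 4 * (u * u) by lra.
have := lebesgue_expanding mA uu4 into_ball expanding.
have := near0 (u * u)^-1; rewrite /= sub0r normrN gtr0_norm// => /(_ rd r0).
rewrite lebesgue_measure_ball ?(ltW r0)// inver gt_eqF ?mulrn_wgt0//.
rewrite lte_pdivrMr ?mulrn_wgt0// -EFinM muA => lt_m le_m.
have [c muc] : exists c, mu (A `&` ball x (u * u)^-1) = c%:E.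
  exists (fine (mu (A `&` ball x (u * u)^-1))); rewrite fineK//.
  by rewrite ge0_fin_numE//; apply: lt_trans lt_m _; rewrite ltry.
move: lt_m le_m; rewrite muc lte_fin -EFinM lee_fin => lt_m le_m.
have : u * u * c < m / 4.
  have -> : m / 4 = u * u * (m / 8 * ((u * u)^-1 *+ 2)).
    by rewrite -mulr_natr; field; rewrite gt_eqF.
  by rewrite ltr_pM2l.
lra.
Qed.
End ZeroOne.

(** * Antisymmetric relations with null or full sections *)

(** Let U be the set of the x with a full section.  For x in U, almost no y
    satisfies A (y, x), so the set V of the pairs (x, y) with x in U and
    A (y, x) is null.  Seen from the other side, for y in U almost every x of
    U gives a pair (x, y) of V; by Fubini, U is null, and so is A. *)
Lemma antisymmetric_zero_one d (T : measurableType d) (R : realType)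
    (m : {sigma_finite_measure set T -> \bar R}) (X : set T) (A : set (T * T)) :
  measurable A -> A `<=` X `*` X -> (forall x y, A (x, y) -> ~ A (y, x)) ->
  (forall x, X x -> m (xsection A x) = 0%E \/
    m.-negligible (X `\` xsection A x)) ->
  (m \x m)%E A = 0%E.
Proof.
move=> mA AX anti zo.
have mAx := measurable_fun_xsection m mA.
pose U := [set x | m (xsection A x) != 0%E].
have mU : measurable U.
  have -> : U = setT `&` (m \o xsection A) @^-1` (~` [set 0%E]).
    by apply/seteqP; split => x /= => [/eqP|[_ /eqP]].
  by apply: mAx => //; exact: measurableC.
have UX x : U x -> X x.
  move=> /eqP Ux; apply/not_notP => nXx; apply: Ux.
  rewrite (_ : xsection A x = set0) ?measure0//.
  by apply/seteqP; split => // y /xsectionP /AX[].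
have Ufull x : U x -> m.-negligible (X `\` xsection A x).
  by move=> Ux; case: (zo x (UX x Ux)) => // A0; rewrite /U /= A0 eqxx in Ux.
pose V := (U `*` setT) `&` (fun z => (z.2, z.1)) @^-1` A.
have mV : measurable V.
  apply: measurableI; first exact: measurableX.
  by rewrite -[X in measurable X]setTI; apply: measurable_swap.
have V0 x : m (xsection V x) = 0%E.
  have [Ux|nUx] := pselect (U x); last first.
    rewrite (_ : xsection V x = set0) ?measure0//.
    by apply/seteqP; split => // y /xsectionP[[]].
  apply/negligibleP; first exact: measurable_xsection.
  apply: negligibleS (Ufull x Ux) => y /xsectionP[_ /= Ayx]; split.
    by have [] := AX _ Ayx.
  by move=> /xsectionP /anti.
have : (\int[m]_y m (ysection V y))%E = 0%E.
  have := indic_fubini_tonelli m m mV.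
  rewrite (indic_fubini_tonelli_FE m mV) (indic_fubini_tonelli_GE m mV) => <-.
  by apply: integral0_eq => x _ /=.
have mVy := measurable_fun_ysection m mV.
rewrite (_ : (\int[m]_y m (ysection V y))%E =
    (\int[m]_(y in setT) `|(m \o ysection V) y|)%E); last first.
  by apply: eq_integral => y _; rewrite gee0_abs.
move=> /(ae_eq_integral_abs m measurableT mVy) aeV.
have negU : m.-negligible U.
  have [[y Uy]|noU] := pselect (exists y, U y); last first.
    rewrite (_ : U = set0); first exact: negligible_set0.
    by apply/seteqP; split => // y Uy; apply: noU; exists y.
  have [allU|] := pselect (forall y, U y -> m (ysection V y) != 0%E).
    by apply: negligibleS aeV => z Uz /= /(_ I); apply/eqP/allU.
  move=> /existsNP[{Uy} y] /not_implyP[Uy /negP]; rewrite negbK => /eqP Vy0.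
  have Vy_neg : m.-negligible (ysection V y).
    by apply/negligibleP => //; exact: measurable_ysection.
  apply: negligibleS (negligibleU Vy_neg (Ufull y Uy)) => x Ux.
  have [Ayx|nAyx] := pselect (A (y, x)); [left|right].
    by apply/ysectionP; split.
  by split; [exact: UX|move=> /xsectionP].
rewrite /product_measure1.
transitivity (\int[m]_x `|(m \o xsection A) x|)%E.
  by apply: eq_integral => x _; rewrite gee0_abs.
apply/(ae_eq_integral_abs m measurableT mAx).
apply: negligibleS negU => x /= Ax; apply/negP => /eqP Ax0; apply: Ax => _.
exact: Ax0.
Qed.

(** * Pairs with divergent difference *)

Section Divergence.
Context {R : realType}.
Local Notation mu := (@lebesgue_measure R).

Lemma measurable_funV d (T : measurableType d) (f : T -> R) :
  measurable_fun setT f -> measurable_fun setT (fun t => (f t)^-1).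
Proof.
move=> mf.
(* real powers of `|f t| are measurable; the factor f t restores the sign, and
   both sides vanish with f t *)
have -> : (fun t => (f t)^-1) = (fun t => f t * (`|f t| `^ (-1)) ^+ 2).
  apply/funext => t; rewrite powR_inv1//.
  have [->|f0] := eqVneq (f t) 0.
    by rewrite invr0 mul0r.
  by rewrite exprVn real_normK ?num_real//; field.
apply: measurable_funM => //; apply: measurable_funX.
apply: (measurableT_comp (f := @powR R ^~ (-1))); first exact: measurable_powR.
exact: measurableT_comp.
Qed.

Lemma measurable_digit d (T : measurableType d) (f : T -> R) :
  measurable_fun setT f -> measurable_fun setT (fun t => (digit (f t))%:~R : R).
Proof.
move=> mf; apply: (measurableT_comp (f := fun x : R => (Num.floor x)%:~R : R)).
  by apply: nondecreasing_measurable => // s t st; rewrite ler_int le_floor.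
exact: measurable_funV.
Qed.

Lemma measurable_cost d (T : measurableType d) n (f g : T -> R) :
  measurable_fun setT f -> measurable_fun setT g ->
  measurable_fun setT (fun t => cost n (f t) (g t)).
Proof.
elim: n f g => [|n IHn] f g mf mg //=.
have mgauss : measurable_fun setT (fun t => gauss (f t)).
  by apply: measurable_funB; [exact: measurable_funV|exact: measurable_digit].
have mpast : measurable_fun setT (fun t => past (f t) (g t)).
  apply: measurable_funV; apply: measurable_funD => //.
  exact: measurable_digit.
apply: measurable_funD; last exact: IHn.
apply: measurable_funM; first exact: measurable_funB.
by apply: measurable_funV; apply: measurable_funD => //; exact: measurable_funM.
Qed.

Definition cost_diff n (z : R * R) : R := cost n z.1 0 - cost n z.2 0.

Definition outgrows : set (R * R) :=
  (unit_irr `*` unit_irr) `&`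
  \bigcap_M \bigcup_N \bigcap_(n in [set n | (N <= n)%N])
    [set z | M%:R <= cost_diff n z].

Lemma measurable_outgrows :
  measurable (outgrows : set (measurableTypeR R * measurableTypeR R)).
Proof.
apply: measurableI; first by apply: measurableX; exact: unit_irr_measurable.
apply: bigcapT_measurable => M; apply: bigcupT_measurable => N.
apply: bigcap_measurable => [|n _]; first by exists N => /=.
rewrite -[X in measurable X]setTI.
apply: (@measurable_fun_ler _ _ _ _ (cst M%:R) (cost_diff n)) => //.
by apply: measurable_funB; exact: measurable_cost.
Qed.

Lemma outgrows_antisymmetric x y : outgrows (x, y) -> ~ outgrows (y, x).
Proof.
move=> [_ xy] [_ yx]; have [N _ xyN] := xy 1%N I; have [N' _ yxN] := yx 1%N I.
have /= := xyN (maxn N N') (leq_maxl _ _).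
have /= := yxN (maxn N N') (leq_maxr _ _).
by rewrite /cost_diff/=; lra.
Qed.

Lemma outgrows_branch (a : int) x y : 1 <= a ->
  outgrows (x, y) -> outgrows (x, (a%:~R + y)^-1).
Proof.
move=> a1 [[/= ux uy] xy]; split.
  by split => //; exact: branch_unit_irr.
move=> M _; have [N _ xyN] := xy (M + 5)%N I; exists N => // n /= Nn.
have /= := xyN n Nn; rewrite /cost_diff/= natrD.
by have := cost_branch n a1 uy; lra.
Qed.

Lemma outgrows_null : (mu \x mu)%E outgrows = 0%E.
Proof.
apply: (@antisymmetric_zero_one _ _ _ lebesgue_measure unit_irr outgrows).
- exact: measurable_outgrows.
- by move=> z [].
- exact: outgrows_antisymmetric.
- move=> x ux; apply: zero_one.
  + exact: (measurable_xsection x measurable_outgrows).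
  + by move=> y /xsectionP[[]].
  + by move=> a t a1 /xsectionP At; apply/xsectionP; exact: outgrows_branch.
Qed.

(** Once |u n| >= 1, a change of sign would be a jump of length at least 2. *)
Lemma eventually_ge_sign (u : nat -> R) :
  (forall n, `|u n.+1 - u n| <= 1) ->
  (forall M : nat, exists N, forall n, (N <= n)%N -> M%:R <= `|u n|) ->
  (forall M : nat, exists N, forall n, (N <= n)%N -> M%:R <= u n) \/
  (forall M : nat, exists N, forall n, (N <= n)%N -> M%:R <= - u n).
Proof.
move=> u1 uy; have [N1 uN1] := uy 1%N.
have [uN|uN] := lerP 0 (u N1); [left|right] => M; have [N uN_M] := uy M;
    exists (maxn N1 N) => n; rewrite geq_max => /andP[N1n /uN_M].
  suff : 1 <= u n by move=> un; rewrite ger0_norm//; lra.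
  elim: n N1n => [|n IHn].
    rewrite leqn0 => /eqP N10.
    by have := uN1 _ (leqnn N1); rewrite ger0_norm// N10.
  rewrite leq_eqVlt => /predU1P[<-|].
    by have := uN1 _ (leqnn N1); rewrite ger0_norm.
  rewrite ltnS => N1n; have := IHn N1n; have := uN1 _ (leqW N1n).
  by have := u1 n; rewrite ler_norml ler_normr => /andP[? ?] /orP[]; lra.
suff : u n <= -1 by move=> un; rewrite ler0_norm//; lra.
elim: n N1n => [|n IHn].
  rewrite leqn0 => /eqP N10.
  by have := uN1 _ (leqnn N1); rewrite ltr0_norm// N10; lra.
rewrite leq_eqVlt => /predU1P[<-|].
  by have := uN1 _ (leqnn N1); rewrite ltr0_norm//; lra.
rewrite ltnS => N1n; have := IHn N1n; have := uN1 _ (leqW N1n).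
by have := u1 n; rewrite ler_norml ler_normr => /andP[? ?] /orP[]; lra.
Qed.

Lemma limn_einf_pinfty (u : nat -> R) :
  limn_einf (EFin \o u) = +oo%E ->
  forall M : nat, exists N, forall n, (N <= n)%N -> M%:R <= u n.
Proof.
have /cvg_lim supE := @cvg_einfs_sup _ (EFin \o u).
rewrite limn_einf_lim supE// => uy M.
have : ((M%:R)%:E < ereal_sup (range (einfs (EFin \o u))))%E by rewrite uy ltry.
move=> /ereal_sup_gt[_ [N _ <-]] MN; exists N => n Nn.
rewrite -lee_fin; apply: le_trans (ltW MN) _.
by apply: ereal_inf_lbound; exists n.
Qed.

End Divergence.

Theorem theorem4 (R : realType) :
  {ae (@lebesgue_measure R \x @lebesgue_measure R)%E,
    forall x : R * R,
      x.1 \in `[0, 1] -> x.2 \in `[0, 1] ->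
      irrational x.1 -> irrational x.2 ->
      (limn_einf (fun n : nat =>
         (`|psi_integral x.1 n - psi_integral x.2 n|)%:E) < +oo)%E}.
Proof.
pose sw (z : R * R) := (z.2, z.1).
have neg_out :
    (lebesgue_measure \x lebesgue_measure)%E.-negligible (@outgrows R).
  by apply/negligibleP; [exact: measurable_outgrows | exact: outgrows_null].
(* the sections of the mirror image are those of [outgrows] in the other
   variable *)
have neg_sw : (lebesgue_measure \x lebesgue_measure)%E.-negligible
    (sw @^-1` @outgrows R).
  have msw : measurable (sw @^-1` @outgrows R).
    rewrite -[X in measurable X]setTI; apply: measurable_swap => //.
    exact: measurable_outgrows.
  apply/negligibleP => //; rewrite -(@outgrows_null R) /product_measure1.
  have := indic_fubini_tonelli lebesgue_measure lebesgue_measure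
    (@measurable_outgrows R).
  rewrite (indic_fubini_tonelli_FE _ (@measurable_outgrows R)).
  rewrite (indic_fubini_tonelli_GE _ (@measurable_outgrows R)) => ->.
  by apply: eq_integral => x _; rewrite /= !(xsectionE, ysectionE).
apply: negligibleS (negligibleU neg_out neg_sw) => -[x y] /= bad.
have [ux uy liminf_y] : [/\ unit_irr x, unit_irr y &
    limn_einf (EFin \o fun n => `|cost_diff n (x, y)|) = +oo%E].
  have [x01|nx] := boolP (x \in `[0, 1]); last first.
    by case: bad => /=; rewrite (negbTE nx).
  have [y01|ny] := boolP (y \in `[0, 1]); last first.
    by case: bad => /= _; rewrite (negbTE ny).
  have [ix|nix] := pselect (irrational x); last by case: bad.
  have [iy|niy] := pselect (irrational y); last by case: bad.
  have [ux uy] := (unit_irr_itv x01 ix, unit_irr_itv y01 iy).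
  split=> //; apply/eqP; rewrite -leye_eq leNgt.
  apply/negP => fin; apply: bad => /= _ _ _ _.
  apply: le_lt_trans fin; rewrite le_eqVlt; apply/orP; left.
  apply/eqP; congr limn_einf.
  by apply/funext => n; rewrite /= !psi_integral_cost.
have incr n : `|cost_diff n.+1 (x, y) - cost_diff n (x, y)| <= 1.
  have := cost_increment n ux (lexx 0); have := cost_increment n uy (lexx 0).
  rewrite /cost_diff ler_norml => /andP[? ?] /andP[? ?]; apply/andP; split.
    by rewrite [fst _]/= [snd _]/=; lra.
  by rewrite [fst _]/= [snd _]/=; lra.
have [xy|yx] := eventually_ge_sign incr (limn_einf_pinfty liminf_y);
  [left|right].
  by split => // M _; have [N xyN] := xy M; exists N.
split => // M _; have [N yxN] := yx M; exists N => // n /= Nn.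
by have := yxN n Nn; rewrite /cost_diff/= opprB.
Qed.
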